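(* Let $b\ge2$, let $N$ be a positive integer with $\gcd(N,b)=1$, and let $p$ be a prime divisor of $b-1$. Then there exists a positive integer $s$ such that $\mathcal{M}_b(p^tN)=\varnothing$ for every integer $t>s$.
   Context: $|b|_N$ denotes the multiplicative order of $b$ modulo $N$ (for $\gcd(N,b)=1$), and $\mathbb{U}_N=\{x: 1\le x<N,\ \gcd(x,N)=1\}$. Midy's set: for an integer $d\ge 2$ dividing $|b|_N$, put $L=|b|_N$ and $k=L/d$. For $x\in\mathbb{U}_N$, let $a_1\cdots a_L$ be the base-$b$ digits (padded with leading zeros to exactly $L$ digits) of the integer $x(b^L-1)/N$ (the period of the base-$b$ expansion of $x/N$). For $j=1,\dots,d$ let $A_j=[a_{(j-1)k+1}\cdots a_{jk}]_b$ be the integer with the $j$-th block of $k$ digits, and $S_d(x)=\sum_{j=1}^d A_j$. $N$ has the Midy property for $b$ and $d$ if $b^k-1\mid S_d(x)$ for all $x\in\mathbb{U}_N$; the Midy set $\mathcal{M}_b(N)$ is the set of integers $d\ge2$ dividing $|b|_N$ for which this holds. *)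

(* Defs.v *)
From mathcomp Require Import all_boot.
From mathcomp Require Import cyclic.
From mathcomp Require Import classical_sets.

Set Implicit Arguments.
Unset Strict Implicit.
Unset Printing Implicit Defensive.

Lemma mult_order_subproof b N :
  exists m, (0 < m) && (coprime N b ==> (b ^ m == 1 %[mod N])).
Proof.
have [coNb|_] := boolP (coprime N b); last by exists 1.
case: (posnP N) coNb => [->|N_gt0] coNb.
  by exists 1; move: coNb; rewrite /coprime gcd0n => /eqP ->.
exists (totient N); rewrite totient_gt0 N_gt0 /=.
by apply/eqP/Euler_exp_totient; rewrite coprime_sym.
Qed.

(* The least m > 0 with b ^ m = 1 mod N; junk value 1 if N, b are not coprime. *)
Definition mult_order (b N : nat) : nat := ex_minn (mult_order_subproof b N).

Lemma mult_orderP b N : coprime N b ->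
  [/\ 0 < mult_order b N, b ^ mult_order b N = 1 %[mod N]
    & forall m, 0 < m -> b ^ m = 1 %[mod N] -> mult_order b N <= m].
Proof.
move=> coNb; rewrite /mult_order; case: ex_minnP => m.
rewrite coNb /= => /andP[m_gt0 /eqP bm] min_m; split=> // n n_gt0 bn.
by apply: min_m; rewrite n_gt0; apply/eqP.
Qed.

(* The L lowest base-b digits of m, most significant first. *)
Definition digits (b L m : nat) : seq nat :=
  mkseq (fun i => (m %/ b ^ (L - i.+1)) %% b) L.

Definition digits_val (b : nat) (s : seq nat) : nat :=
  foldl (fun v a => v * b + a) 0 s.

(* The period of the base-b expansion of x / N. The division is exact when
   N and b are coprime. *)
Definition period (b N x : nat) : seq nat :=
  let L := mult_order b N in digits b L ((x * (b ^ L - 1)) %/ N).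

Lemma period_exact b N x : coprime N b -> N %| x * (b ^ mult_order b N - 1).
Proof.
move=> coNb; have [L_gt0 bL _] := mult_orderP coNb; apply: dvdn_mull.
have [b0|b_gt0] := posnP b; first by rewrite {1}b0 exp0n ?sub0n ?dvdn0.
have bL_gt0: 0 < b ^ mult_order b N by rewrite expn_gt0 b_gt0.
by rewrite -eqn_mod_dvd //; apply/eqP.
Qed.

(* Blocks are numbered from 0: midy_block b N d x j is A_(j+1). *)
Definition midy_block (b N d x j : nat) : nat :=
  let k := mult_order b N %/ d in
  digits_val b (take k (drop (j * k) (period b N x))).

Definition midy_sum (b N d x : nat) : nat := \sum_(j < d) midy_block b N d x j.

Definition midy_property (b N d : nat) : Prop :=
  forall x, 1 <= x < N -> coprime x N ->
    b ^ (mult_order b N %/ d) - 1 %| midy_sum b N d x.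

Definition midy_set (b N : nat) : set nat :=
  [set d | [/\ 2 <= d, d %| mult_order b N & midy_property b N d]]%classic.

(* Main.v *)
Require Import Defs.
From mathcomp Require Import all_boot.
From mathcomp Require Import classical_sets.

(** Since b^k = 1 modulo b^k - 1, the sum of the blocks is congruent to the whole
    period, so (taking x = 1) Midy's property for M = p^t N forces
    M (b^k - 1) to divide b^L - 1, where L = |b|_M. As p divides b^k - 1, the
    p-adic valuation of b^L - 1 then exceeds T := v_p(M). On the other hand, put
    B = b^(p |b|_N) and e = v_p(B - 1) >= 2. Lifting the exponent gives
    v_p(B^(p^i) - 1) = e + i, so for T >= e the number B^(p^(T-e)) - 1 has
    valuation exactly T. It is divisible by M, hence by b^L - 1: contradiction. *)

Set Implicit Arguments.
Unset Strict Implicit.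
Unset Printing Implicit Defensive.

Lemma expn_mod1 b n m : b = 1 %[mod m] -> b ^ n = 1 %[mod m].
Proof. by move=> b1; rewrite -modnXm b1 modnXm exp1n. Qed.

Lemma mult_order_dvd b N m :
  coprime N b -> b ^ m = 1 %[mod N] -> mult_order b N %| m.
Proof.
move=> coNb bm1; have [L_gt0 bL minL] := mult_orderP coNb.
rewrite /dvdn; have [//|r_gt0] := posnP (m %% mult_order b N).
have br1: b ^ (m %% mult_order b N) = 1 %[mod N].
  rewrite -bm1 [in RHS](divn_eq m (mult_order b N)) expnD.
  rewrite -[in RHS]modnMml (mulnC (_ %/ _)) expnM.
  by rewrite (expn_mod1 (m %/ _) bL) modnMml mul1n.
by have := minL _ r_gt0 br1; rewrite leqNgt ltn_pmod.
Qed.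

Lemma digits_val_cat b s1 s2 :
  digits_val b (s1 ++ s2) = digits_val b s1 * b ^ size s2 + digits_val b s2.
Proof.
elim/last_ind: s2 => [|s2 a IHs]; first by rewrite cats0 expn0 muln1 addn0.
rewrite -rcons_cat /digits_val !foldl_rcons -!/(digits_val _ _) IHs size_rcons.
by rewrite mulnDl -mulnA -expnSr addnA.
Qed.

Lemma digits_val_digits b L m : digits_val b (digits b L m) = m %% b ^ L.
Proof.
elim: L m => [|L IHL] m; first by rewrite expn0 modn1.
have -> : digits b L.+1 m = digits b L (m %/ b) ++ [:: m %% b].
  rewrite /digits /mkseq -[L.+1]addn1 iotaD map_cat /= add0n addn1 subnn divn1.
  congr (_ ++ _); apply/eq_in_map => i; rewrite mem_iota /= add0n => ltiL.
  by rewrite subSn // expnS divnMA.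
rewrite digits_val_cat IHL expn1 /digits_val /= mul0n add0n.
(* Since [(m %/ b) %% b ^ L] equals [(m %% b ^ L.+1) %/ b], the goal is Euclidean division of
   [m %% b ^ L.+1] by [b]. *)
rewrite modn_divl -expnSr -(modn_dvdm m (_ : b %| b ^ L.+1)).
  by rewrite -divn_eq.
by rewrite expnS dvdn_mulr.
Qed.

Lemma digits_val_blocks b k d s : 0 < b -> size s = d * k ->
  \sum_(j < d) digits_val b (take k (drop (j * k) s))
    = digits_val b s %[mod b ^ k - 1].
Proof.
move=> b_gt0; elim: d s => [|d IHd] s sz_s.
  by rewrite big_ord0; move/size0nil: sz_s => ->.
(* The leading block is split off; its weight in the whole value is [b ^ (d * k)], which is 1 modulo
   [b ^ k - 1]. *)
rewrite big_ord_recl mul0n drop0 -[in RHS](cat_take_drop k s) digits_val_cat.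
have sz_drop: size (drop k s) = d * k by rewrite size_drop sz_s mulSn addKn.
have bdk1: b ^ (d * k) = 1 %[mod b ^ k - 1].
  apply/eqP; rewrite eqn_mod_dvd ?expn_gt0 ?b_gt0 //.
  by rewrite mulnC expnM !subn1 dvdn_pred_predX.
rewrite sz_drop -[in RHS]modnDml -modnMmr bdk1 modnMmr muln1 modnDml.
rewrite -modnDmr -[in RHS]modnDmr -(IHd _ sz_drop); congr ((_ + _ %% _) %% _).
by apply: eq_bigr => j _; rewrite drop_drop /= /bump /= add1n mulSn addnC.
Qed.

Lemma midy_sum_mod b N d x : 0 < b -> coprime N b -> d %| mult_order b N ->
    x < N ->
  midy_sum b N d x = x * (b ^ mult_order b N - 1) %/ N
    %[mod b ^ (mult_order b N %/ d) - 1].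
Proof.
move=> b_gt0 coNb d_dvd ltxN; rewrite /midy_sum /midy_block.
rewrite digits_val_blocks // ?size_mkseq; last by rewrite mulnC divnK.
(* As [x < N], the quotient is below [b ^ L] with [L = mult_order b N], so keeping only [L] digits
   loses nothing. *)
rewrite digits_val_digits [X in X %% _ = _]modn_small //.
have N_gt0 := leq_ltn_trans (leq0n x) ltxN.
rewrite ltn_divLR // mulnC (@leq_ltn_trans (b ^ mult_order b N * x)) //.
  by rewrite leq_mul2r leq_subr orbT.
by rewrite ltn_pmul2l ?expn_gt0 ?b_gt0.
Qed.

Lemma midy_property_dvd b N d : 0 < b -> 1 < N -> coprime N b ->
    d %| mult_order b N -> midy_property b N d ->
  N * (b ^ (mult_order b N %/ d) - 1) %| b ^ mult_order b N - 1.
Proof.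
move=> b_gt0 N_gt1 coNb d_dvd /(_ 1); rewrite N_gt1 coprime1n => /(_ isT isT).
rewrite {1}/dvdn midy_sum_mod // -/(dvdn _ _) mul1n => D_dvd.
(* The division by [N] is exact, so multiplying [D_dvd] by [N] restores [b ^ L - 1] on the right. *)
have := period_exact 1 coNb; rewrite mul1n => /divnK <-.
by rewrite mulnC dvdn_pmul2r // ltnW.
Qed.

Lemma sum_expn_mod b n m : b = 1 %[mod m] -> \sum_(i < n) b ^ i = n %[mod m].
Proof.
move=> b1; elim: n => [|n IHn]; first by rewrite big_ord0.
rewrite big_ord_recr /= -modnDml IHn modnDml -modnDmr expn_mod1 //.
by rewrite modnDmr addn1.
Qed.

Lemma dvdn_pred_mod m b : 0 < b -> m %| b.-1 -> b = 1 %[mod m].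
Proof. by move=> b_gt0; rewrite -subn1 -eqn_mod_dvd // => /eqP. Qed.

(** In [b ^ p - 1 = (b - 1) * \sum_(i < p) b ^ i] both factors are divisible by [p], the sum being
    congruent to [p] modulo [p]. *)
Lemma sqr_dvdn_pred_exp p b : 0 < b -> p %| b.-1 -> p ^ 2 %| (b ^ p).-1.
Proof.
move=> b_gt0 p_dvd; rewrite predn_exp expnS expn1 dvdn_mul //.
have b1: b = 1 %[mod p] by rewrite dvdn_pred_mod.
by rewrite /dvdn sum_expn_mod // modnn.
Qed.

(* The hypothesis modulo p^2 rather than p makes p = 2 unexceptional. *)
Lemma logn_pred_exp_prime p b : prime p -> 1 < b -> p ^ 2 %| b.-1 ->
  logn p (b ^ p).-1 = (logn p b.-1).+1.
Proof.
move=> p_pr b_gt1 p2_dvd; have p_gt1 := prime_gt1 p_pr.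
have b1 := dvdn_pred_mod (ltnW b_gt1) p2_dvd.
have sum_p := sum_expn_mod p b1.
have sum_gt0: 0 < \sum_(i < p) b ^ i.
  rewrite lt0n; apply: contra_eq_neq sum_p => ->.
  by rewrite mod0n modn_small ?ltn_Pmull ?prime_gt0 // eq_sym -lt0n prime_gt0.
have pred_gt0: 0 < b.-1 by rewrite -ltnS prednK // ltnW.
(* The cofactor of [b.-1] is congruent to [p] modulo [p ^ 2], so its valuation is exactly 1. *)
rewrite predn_exp lognM // -addn1; congr (_ + _); apply/eqP.
rewrite eqn_leq leqNgt -!pfactor_dvdn // expn1.
rewrite /dvdn sum_p -/(dvdn _ _) -{2}[p]expn1 dvdn_Pexp2l //=.
by rewrite -(modn_dvdm _ (dvdn_mulr p (dvdnn p))) sum_p modn_dvdm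
  ?modnn ?dvdn_mulr.
Qed.

Lemma logn_pred_exp_pexp p b i : prime p -> 1 < b -> p ^ 2 %| b.-1 ->
  logn p (b ^ (p ^ i)).-1 = logn p b.-1 + i.
Proof.
move=> p_pr b_gt1 p2_dvd; elim: i => [|i IHi]; first by rewrite expn1 addn0.
rewrite expnSr expnM logn_pred_exp_prime // ?IHi ?addnS //.
  by rewrite -(exp1n (p ^ i)) ltn_exp2r // expn_gt0 prime_gt0.
by rewrite (dvdn_trans p2_dvd) ?dvdn_pred_predX.
Qed.

Theorem theorem2p9 (b N p : nat) (b_ge2 : 2 <= b) (N_gt0 : 0 < N)
    (coNb : coprime N b) (p_prime : prime p) (p_dvd : p %| b - 1) :
  exists s : nat, 0 < s /\
    forall t : nat, s < t -> midy_set b (p ^ t * N) = set0.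
Proof.
have b_gt0 := ltnW b_ge2; have p_gt1 := prime_gt1 p_prime.
have [g_gt0 bg _] := mult_orderP coNb; set g := mult_order b N in g_gt0 bg.
have gp_gt0: 0 < g * p by rewrite muln_gt0 g_gt0 prime_gt0.
(* The exponent [g] makes [N] divide [B - 1]; the extra factor [p] yields [p ^ 2 %| B.-1], the
   starting point for lifting. *)
pose B := b ^ (g * p); pose e := logn p B.-1.
have B_gt1: 1 < B by rewrite -(exp1n (g * p)) ltn_exp2r.
have p2_dvd: p ^ 2 %| B.-1.
  rewrite /B expnM sqr_dvdn_pred_exp ?expn_gt0 ?b_gt0 //.
  by rewrite (dvdn_trans p_dvd) // subn1 dvdn_pred_predX.
have e_gt0: 0 < e.
  have: 2 <= e by rewrite -pfactor_dvdn // -ltnS prednK // ltnW.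
  exact: ltnW.
have copb: coprime p b.
  by apply: coprime_dvdl p_dvd _; rewrite subn1 coprimePn.
exists e; split=> // t lt_et; set M := p ^ t * N.
have coMb: coprime M b by rewrite coprimeMl coNb coprimeXl.
have M_gt1: 1 < M.
  rewrite (@leq_trans (p ^ t)) ?leq_pmulr //.
  by rewrite -(expn0 p) ltn_exp2l // (leq_ltn_trans _ lt_et).
(* [T] is the valuation of [M] at [p]. As [e <= T], the subtraction is not truncated, and
   [b ^ m - 1] has valuation [e + (T - e) = T]. *)
pose T := t + logn p N; pose m := g * p * p ^ (T - e).
have le_eT: e <= T by rewrite (leq_trans (ltnW lt_et)) ?leq_addr.
have ME: M = p ^ T * N`_p^'.
  by rewrite /M -{1}(partnC p N_gt0) p_part mulnA -expnD.
have bm_gt0: 0 < b ^ m by rewrite expn_gt0 b_gt0.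
have log_bm: logn p (b ^ m).-1 = T.
  by rewrite /m expnM logn_pred_exp_pexp // subnKC.
have bm_pred_gt0: 0 < (b ^ m).-1.
  rewrite -ltnS prednK // -(exp1n m) ltn_exp2r // muln_gt0 gp_gt0 /=.
  by rewrite expn_gt0 prime_gt0.
(* The coprime parts of [M] are treated separately: [p ^ T] by the valuation, the [p']-part of [N]
   because [g] divides [m]. *)
have bm1: b ^ m = 1 %[mod M].
  apply/eqP; rewrite eqn_mod_dvd // subn1 ME Gauss_dvd; last first.
    by rewrite coprimeXl // (pnat_coprime (pnat_id p_prime)) ?part_pnat.
  rewrite pfactor_dvdn // log_bm leqnn /= (dvdn_trans (dvdn_part _ _)) //.
  rewrite -subn1 -eqn_mod_dvd // /m -mulnA expnM.
  by rewrite expn_mod1.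
have [q mE] := dvdnP (mult_order_dvd coMb bm1).
apply/seteqP; split=> // d [d_ge2 d_dvd /midy_property_dvd].
move=> /(_ b_gt0 M_gt1 coMb d_dvd) midy_dvd.
(* [M] supplies [p ^ T], and [b ^ k - 1], a multiple of [b - 1], supplies one more [p]. *)
have dvd_bm: p ^ T.+1 %| (b ^ m).-1.
  rewrite (@dvdn_trans (b ^ mult_order b M - 1)) //; last first.
    by rewrite mE mulnC expnM subn1 dvdn_pred_predX.
  apply: dvdn_trans midy_dvd; rewrite expnSr dvdn_mul //.
    by rewrite ME dvdn_mulr.
  by rewrite (dvdn_trans p_dvd) // !subn1 dvdn_pred_predX.
by move: dvd_bm; rewrite pfactor_dvdn // log_bm ltnn.
Qed.
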